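(* For $\epsilon>0$ let $(x^\epsilon,y^\epsilon,\lambda^\epsilon)$ be the unique solution of the regularized two-stage problem $$0\le x\ \perp\ Cx-\mathbb{E}[\lambda(\xi)]+a\ge 0,$$ $$0\le\begin{pmatrix}y(\xi)\\ \lambda(\xi)\end{pmatrix}\ \perp\ \begin{pmatrix}\Pi(\xi)& I\\ -I&\epsilon I\end{pmatrix}\begin{pmatrix}y(\xi)\\ \lambda(\xi)\end{pmatrix}+\begin{pmatrix}-p(\xi)\\ x\end{pmatrix}\ge 0\quad\text{for a.e. }\xi\in\Xi.$$ Then any accumulation point of $\{(x^\epsilon,y^\epsilon,\lambda^\epsilon)\}$ as $\epsilon\downarrow0$ is a solution of the two-stage stochastic complementarity problem $$0\le x\ \perp\ Cx-\mathbb{E}[\lambda(\xi)]+a\ge 0,$$ $$0\le\begin{pmatrix}y(\xi)\\ \lambda(\xi)\end{pmatrix}\ \perp\ \begin{pmatrix}\Pi(\xi)& I\\ -I&0\end{pmatrix}\begin{pmatrix}y(\xi)\\ \lambda(\xi)\end{pmatrix}+\begin{pmatrix}-p(\xi)\\ x\end{pmatrix}\ge 0\quad\text{for a.e. }\xi\in\Xi.$$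
   Context: $J\ge 1$ is an integer and $\mathcal{J}=\{1,\dots,J\}$. $\xi$ is a random vector with support $\Xi\subseteq\mathbb{R}^d$ and induced probability space $(\Xi,\mathcal{F},P)$; ''a.e.'' refers to $P$. $C=\mathrm{diag}(c_1,\dots,c_J)$ with all $c_j>0$; $a=(a_1,\dots,a_J)^T$ with all $a_j>0$. $p(\xi)=(p_1(\xi),\dots,p_J(\xi))^T$ with each $p_j:\Xi\to\mathbb{R}$ measurable. $\gamma:\Xi\to\mathbb{R}_+$ is measurable and there is a constant $\gamma_0>0$ with $\gamma(\xi)\ge\gamma_0$ for a.e. $\xi\in\Xi$. $\Pi(\xi)=\gamma(\xi)(ee^T+I)$, where $e=(1,\dots,1)^T\in\mathbb{R}^J$ and $I$ is the $J\times J$ identity. The notation $0\le u\perp v\ge0$ means $u\ge 0$, $v\ge 0$ componentwise and $u^Tv=0$. The unknowns of the regularized problem are $x\in\mathbb{R}^J$ and measurable $y,\lambda:\Xi\to\mathbb{R}^J$ (with $\lambda$ integrable so that $\mathbb{E}[\lambda(\xi)]$ makes sense); functions are identified when equal a.e. For each $\epsilon>0$ the regularized problem has a unique solution. A solution of the (unregularized) two-stage problem is a triple $(x,y,\lambda)$ with $x\in\mathbb{R}^J$, $y:\Xi\to\mathbb{R}^J$ essentially bounded measurable, $\lambda:\Xi\to\mathbb{R}^J$ integrable, satisfying the displayed relations. An accumulation point of $\{(x^\epsilon,y^\epsilon,\lambda^\epsilon)\}$ as $\epsilon\downarrow0$ is a triple $(\hat x,\hat y,\hat\lambda)$ for which there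 is a sequence $\epsilon_k\downarrow0$ with $x^{\epsilon_k}\to\hat x$ in $\mathbb{R}^J$ and $y^{\epsilon_k}(\xi)\to\hat y(\xi)$, $\lambda^{\epsilon_k}(\xi)\to\hat\lambda(\xi)$ for a.e. $\xi\in\Xi$.
   Formalization: The positive part of each p_j(ξ) is additionally assumed integrable; with p only measurable the claim fails (J=1, c=a=1, ξ uniform on [0,1], γ=1/ξ, p=2γ has accumulation point (1,1,0), not a solution). Accumulation points are taken with measurable components. *)

(* Defs.v *)
From HB Require Import structures.
From mathcomp Require Export all_boot all_order all_algebra.
From mathcomp Require Export all_classical all_reals all_analysis.

Set Implicit Arguments.
Unset Strict Implicit.
Unset Printing Implicit Defensive.

Export Order.TTheory GRing.Theory Num.Theory.
Export numFieldNormedType.Exports.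

Local Open Scope classical_set_scope.
Local Open Scope ring_scope.

(* R^d is [d.-tuple R], which carries the product Borel sigma-algebra; its
   topology is read through the identification with row vectors. *)
Definition tuple_closed (R : realType) (d : nat) (A : set (d.-tuple R)) : Prop :=
  closed [set v : 'rV[R]_d | A [tuple v ord0 i | i < d]].

(* The smallest closed set of full measure. Closed sets being Borel, the
   measurability clauses are redundant. *)
Definition is_support (R : realType) (d : nat)
    (P : probability (d.-tuple R) R) (Xi : set (d.-tuple R)) : Prop :=
  [/\ measurable Xi, tuple_closed Xi, P Xi = 1%E
    & forall F : set (d.-tuple R),
        measurable F -> tuple_closed F -> P F = 1%E -> Xi `<=` F].

Definition vec_ge0 (R : realType) (n : nat) (u : 'cV[R]_n) : Prop :=
  forall i, 0 <= u i ord0.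

Definition complementary (R : realType) (n : nat) (u v : 'cV[R]_n) : Prop :=
  [/\ vec_ge0 u, vec_ge0 v & u^T *m v = 0].

(* Functions on Xi are represented by functions on R^d of which only the
   values on Xi matter. *)
Definition vec_measurable (R : realType) (d n : nat)
    (Xi : set (d.-tuple R)) (f : d.-tuple R -> 'cV[R]_n) : Prop :=
  forall i, measurable_fun Xi (fun z => f z i ord0).

Definition vec_integrable (R : realType) (d n : nat)
    (P : probability (d.-tuple R) R) (Xi : set (d.-tuple R))
    (f : d.-tuple R -> 'cV[R]_n) : Prop :=
  forall i, P.-integrable Xi (fun z => (f z i ord0)%:E).

Definition vec_ess_bounded (R : realType) (d n : nat)
    (P : probability (d.-tuple R) R) (Xi : set (d.-tuple R))
    (f : d.-tuple R -> 'cV[R]_n) : Prop :=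
  exists M : R, {ae P, forall z, Xi z -> forall i, `|f z i ord0| <= M}.

Definition vec_expectation (R : realType) (d n : nat)
    (P : probability (d.-tuple R) R) (Xi : set (d.-tuple R))
    (f : d.-tuple R -> 'cV[R]_n) : 'cV[R]_n :=
  \col_i \int[P]_(z in Xi) f z i ord0.

Definition Pi_mx (R : realType) (J : nat) (g : R) : 'M[R]_J :=
  let e : 'cV[R]_J := const_mx 1 in g *: (e *m e^T + 1%:M).

Definition first_stage (R : realType) (d J : nat)
    (P : probability (d.-tuple R) R) (Xi : set (d.-tuple R))
    (c : 'rV[R]_J) (a : 'cV[R]_J)
    (x : 'cV[R]_J) (l : d.-tuple R -> 'cV[R]_J) : Prop :=
  complementary x (diag_mx c *m x - vec_expectation P Xi l + a).

(* [D] is the lower right block of the matrix: [eps%:M] in the regularized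
   problem and [0] in the original one. *)
Definition second_stage (R : realType) (d J : nat)
    (P : probability (d.-tuple R) R) (Xi : set (d.-tuple R))
    (gamma : d.-tuple R -> R) (p : d.-tuple R -> 'cV[R]_J) (D : 'M[R]_J)
    (x : 'cV[R]_J) (y l : d.-tuple R -> 'cV[R]_J) : Prop :=
  {ae P, forall z, Xi z ->
    complementary (col_mx (y z) (l z))
      (block_mx (Pi_mx J (gamma z)) 1%:M (- 1%:M) D *m col_mx (y z) (l z)
       + col_mx (- p z) x)}.

Definition regularized_solution (R : realType) (d J : nat)
    (P : probability (d.-tuple R) R) (Xi : set (d.-tuple R))
    (c : 'rV[R]_J) (a : 'cV[R]_J)
    (gamma : d.-tuple R -> R) (p : d.-tuple R -> 'cV[R]_J) (eps : R)
    (x : 'cV[R]_J) (y l : d.-tuple R -> 'cV[R]_J) : Prop :=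
  [/\ vec_measurable Xi y, vec_integrable P Xi l,
      first_stage P Xi c a x l
    & second_stage P Xi gamma p eps%:M x y l].

Definition two_stage_solution (R : realType) (d J : nat)
    (P : probability (d.-tuple R) R) (Xi : set (d.-tuple R))
    (c : 'rV[R]_J) (a : 'cV[R]_J)
    (gamma : d.-tuple R -> R) (p : d.-tuple R -> 'cV[R]_J)
    (x : 'cV[R]_J) (y l : d.-tuple R -> 'cV[R]_J) : Prop :=
  [/\ vec_measurable Xi y /\ vec_ess_bounded P Xi y, vec_integrable P Xi l,
      first_stage P Xi c a x l
    & second_stage P Xi gamma p 0 x y l].

(* The limit functions are required to be measurable: an a.e. limit of
   measurable functions is so only up to a null set when P is not complete. *)
Definition accumulation_point (R : realType) (d J : nat)
    (P : probability (d.-tuple R) R) (Xi : set (d.-tuple R))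
    (xe : R -> 'cV[R]_J) (ye le : R -> d.-tuple R -> 'cV[R]_J)
    (x : 'cV[R]_J) (y l : d.-tuple R -> 'cV[R]_J) : Prop :=
  vec_measurable Xi y /\ vec_measurable Xi l /\
  exists eps_ : nat -> R,
    [/\ (forall k, 0 < eps_ k) /\ eps_ @ \oo --> (0 : R),
        xe (eps_ k) @[k --> \oo] --> x,
        {ae P, forall z, Xi z -> ye (eps_ k) z @[k --> \oo] --> y z}
      & {ae P, forall z, Xi z -> le (eps_ k) z @[k --> \oo] --> l z}].

(* Main.v *)
Require Import Defs.
From mathcomp Require Import measurable_realfun.
Local Open Scope classical_set_scope.
Local Open Scope ring_scope.

(** The conditions of both stages are closed: they say that certain pairs of
    nonnegative reals have product zero, and the members of these pairs depend
    continuously on [x], [y], [l], [eps] and, in the first stage, on the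
    expectation of [l]. So the second stage passes to the limit pointwise, off
    the countable union of the null sets attached to the members of the
    sequence ([second_stage_cvg]), and the first stage does so provided the
    expectations converge ([first_stage_cvg]).

    Convergence of the expectations is dominated convergence, with a bound
    coming from the second stage itself ([multiplier_le]). Where the multiplier
    [l j] is positive, complementarity forces [y j = x j + eps * l j > 0]; the
    positive production [y j] in turn makes its own inequality tight, that is
    [l j = p j - g * (\sum_i y i + y j) <= p j]. Hence [0 <= l j <= max (p j) 0]
    for every [eps > 0], and the positive part of [p j] is integrable.

    The limit [y] is essentially bounded because the limiting second stage
    contains [0 <= y <= x]. *)

(** * Complementarity by coordinates *)

Definition scalar_compl {R : realType} (u v : R) : Prop :=
  [/\ 0 <= u, 0 <= v & u * v = 0].

(** A sum of nonnegative products vanishes only if each product does. *)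
Lemma complementaryP {R : realType} {n : nat} {u v : 'cV[R]_n} :
  complementary u v <-> forall i, scalar_compl (u i ord0) (v i ord0).
Proof.
split=> [[u0 v0 uv] i | uv]; last first.
  split=> [i|i|]; try by case: (uv i).
  apply/matrixP => s t; rewrite !ord1 !mxE big1 // => i _.
  by rewrite mxE; case: (uv i).
split=> //; move/matrixP/(_ ord0 ord0): uv; rewrite !mxE.
move/eqP; rewrite psumr_eq0 => [/allP/(_ i (mem_index_enum i))/=|k _].
  by rewrite mxE => /eqP.
by rewrite mxE mulr_ge0.
Qed.

Lemma scalar_compl_cvg {R : realType} {u v : nat -> R} {u' v' : R} :
  (forall k, scalar_compl (u k) (v k)) ->
  u @ \oo --> u' -> v @ \oo --> v' -> scalar_compl u' v'.
Proof.
move=> uv uu' vv'; split.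
- by apply: (cvgr_to_ge uu'); apply: nearW => k; case: (uv k).
- by apply: (cvgr_to_ge vv'); apply: nearW => k; case: (uv k).
have uv0 : (fun k => u k * v k) = fun=> 0.
  by apply/funext => k; case: (uv k).
have uv_cvg : (fun k => u k * v k) @ \oo --> u' * v' by exact: cvgM.
rewrite uv0 in uv_cvg; exact: (cvg_unique _ uv_cvg (cvg_cst 0)).
Qed.

(** The row of [Pi_mx J g] at [j] is [g] times the all-ones row plus [g] at [j],
    whence the total [\sum_i y i] next to [y j]. *)
Lemma second_stage_coordP {R : realType} {J : nat} {g eps : R}
    {p x y l : 'cV[R]_J} :
  complementary (col_mx y l)
    (block_mx (Pi_mx J g) 1%:M (- 1%:M) eps%:M *m col_mx y l + col_mx (- p) x)
  <->
  forall j,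
    scalar_compl (y j ord0)
      (g * (\sum_i y i ord0 + y j ord0) + l j ord0 - p j ord0) /\
    scalar_compl (l j ord0) (x j ord0 + eps * l j ord0 - y j ord0).
Proof.
have Piy j : (Pi_mx J g *m y) j ord0 = g * (\sum_i y i ord0 + y j ord0).
  rewrite /Pi_mx -scalemxAl mulmxDl mul1mx -mulmxA !mxE big_ord1 !mxE mul1r.
  by congr (g * (_ + _)); apply: eq_bigr => i _; rewrite !mxE mul1r.
have row_y j : (Pi_mx J g *m y + l - p) j ord0
    = g * (\sum_i y i ord0 + y j ord0) + l j ord0 - p j ord0.
  by rewrite mxE [X in X + _]mxE Piy [X in _ + X]mxE.
have row_l j : (- y + eps *: l + x) j ord0
    = x j ord0 + eps * l j ord0 - y j ord0.
  by rewrite !mxE addrC addrCA addrC.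
rewrite mul_block_col add_col_mx mul1mx mulNmx mul1mx mul_scalar_mx.
split=> [/complementaryP H j | H].
  have := (H (lshift J j), H (rshift J j)).
  by rewrite !col_mxEu !col_mxEd row_y row_l => -[].
apply/complementaryP => i.
case: (split_ordP i) => j ->; have [Hy Hl] := H j.
  by rewrite !col_mxEu row_y.
by rewrite !col_mxEd row_l.
Qed.

(** The bound is independent of [eps] and of [x], which makes it a common
    dominating function along the whole regularization sequence. If
    [l j > 0], the lower row is tight, so [y j = x j + eps * l j], which is
    positive because [eps] is; then the upper row is tight too, and its
    [Pi_mx] term is nonnegative. *)
Lemma multiplier_le {R : realType} {J : nat} {g eps : R}
    {p x y l : 'cV[R]_J} :
  0 <= g -> 0 < eps -> vec_ge0 x ->
  complementary (col_mx y l)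
    (block_mx (Pi_mx J g) 1%:M (- 1%:M) eps%:M *m col_mx y l
     + col_mx (- p) x) ->
  forall j, l j ord0 <= Num.max (p j ord0) 0.
Proof.
move=> g0 eps0 x0 /second_stage_coordP H j.
have y0 i : 0 <= y i ord0 by case: (H i) => -[].
have [[_ _ yq] [l0 _ lw]] := H j.
rewrite le_max; case: (leP (l j ord0) 0) => [_|lpos]; first by rewrite orbT.
rewrite orbF.
have: x j ord0 + eps * l j ord0 - y j ord0 = 0.
  by move/eqP: lw; rewrite mulf_eq0 gt_eqF //= => /eqP.
move/eqP; rewrite subr_eq0 => /eqP yE.
have [y_eq0|y_neq0] := eqVneq (y j ord0) 0; last first.
  move/eqP: yq; rewrite mulf_eq0 (negPf y_neq0) /= subr_eq0 => /eqP <-.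
  by rewrite lerDr mulr_ge0 // addr_ge0 // sumr_ge0.
have : 0 < y j ord0 by rewrite -yE ltr_wpDl ?mulr_gt0.
by rewrite y_eq0 ltxx.
Qed.

(** * Passage to the limit *)

Lemma cvg_coord {R : realType} {m n : nat}
    {u : nat -> 'M[R]_(m, n)} {u' : 'M[R]_(m, n)} {i j} :
  u @ \oo --> u' -> (u k i j) @[k --> \oo] --> u' i j.
Proof.
move=> uu'; refine (@continuous_cvg _ _ _ _ _ u (fun M : 'M[R]_(m, n) => M i j)
  u' _ uu').
exact: coord_continuous.
Qed.

Lemma cvg_colsum {R : realType} {J : nat}
    {u : nat -> 'cV[R]_J} {u' : 'cV[R]_J} :
  u @ \oo --> u' -> (\sum_i u k i ord0) @[k --> \oo] --> \sum_i u' i ord0.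
Proof.
move=> uu'; apply: cvg_big => [|i _]; first exact: add_continuous.
exact: cvg_coord.
Qed.

(** Stated for an arbitrary limit [eps'] of the regularization parameters; the
    original problem is the case [eps' = 0]. *)
Lemma second_stage_cvg {R : realType} {J : nat} {g : R} {p : 'cV[R]_J}
    {eps : nat -> R} {x y l : nat -> 'cV[R]_J} {eps' : R} {x' y' l' : 'cV[R]_J} :
  (forall k, complementary (col_mx (y k) (l k))
    (block_mx (Pi_mx J g) 1%:M (- 1%:M) (eps k)%:M *m col_mx (y k) (l k)
     + col_mx (- p) (x k))) ->
  eps @ \oo --> eps' -> x @ \oo --> x' -> y @ \oo --> y' -> l @ \oo --> l' ->
  complementary (col_mx y' l')
    (block_mx (Pi_mx J g) 1%:M (- 1%:M) eps'%:M *m col_mx y' l'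
     + col_mx (- p) x').
Proof.
move=> H eps_cvg x_cvg y_cvg l_cvg.
have {}H k := second_stage_coordP.1 (H k).
apply/second_stage_coordP => j; split.
  apply: (scalar_compl_cvg (fun k => (H k j).1)); first exact: cvg_coord.
  apply: cvgB; last exact: cvg_cst.
  apply: cvgD; last exact: cvg_coord.
  apply: cvgM; first exact: cvg_cst.
  by apply: cvgD; [exact: cvg_colsum|exact: cvg_coord].
apply: (scalar_compl_cvg (fun k => (H k j).2)); first exact: cvg_coord.
apply: cvgB; last exact: cvg_coord.
apply: cvgD; first exact: cvg_coord.
by apply: cvgM => //; exact: cvg_coord.
Qed.

(** The multipliers enter the first stage only through their expectations, which
    is why their convergence is expressed that way. *)
Lemma first_stage_cvg {R : realType} {d J : nat}
    {P : probability (d.-tuple R) R} {Xi : set (d.-tuple R)}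
    {c : 'rV[R]_J} {a : 'cV[R]_J}
    {x : nat -> 'cV[R]_J} {l : nat -> d.-tuple R -> 'cV[R]_J}
    {x' : 'cV[R]_J} {l' : d.-tuple R -> 'cV[R]_J} :
  (forall k, first_stage P Xi c a (x k) (l k)) ->
  x @ \oo --> x' ->
  (forall j, \int[P]_(z in Xi) l k z j ord0 @[k --> \oo]
     --> \int[P]_(z in Xi) l' z j ord0) ->
  first_stage P Xi c a x' l'.
Proof.
move=> H x_cvg El_cvg.
have {}H k := complementaryP.1 (H k).
apply/complementaryP => j; apply: (scalar_compl_cvg (H ^~ j)).
  exact: cvg_coord.
rewrite (_ : (fun k => _) = fun k =>
    c ord0 j * x k j ord0 - \int[P]_(z in Xi) l k z j ord0 + a j ord0).
  rewrite mul_diag_mx !mxE.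
  apply: cvgD; last exact: cvg_cst.
  apply: cvgB => //.
  by apply: cvgM; [exact: cvg_cst|exact: cvg_coord].
by apply/funext => k; rewrite mul_diag_mx !mxE.
Qed.

(** [Rintegral] is the [fine] part of an extended-real integral; the limit
    passes through [fine] because the limit function is integrable. *)
Lemma Rintegral_dominated_convergence {d : measure_display}
    {T : measurableType d} {R : realType}
    {mu : {measure set T -> \bar R}} {D : set T} (mD : measurable D)
    {f_ : nat -> T -> R} {f g : T -> R} :
  (forall n, measurable_fun D (f_ n)) -> measurable_fun D f ->
  {ae mu, forall z, D z -> f_ n z @[n --> \oo] --> f z} ->
  mu.-integrable D (EFin \o g) ->
  {ae mu, forall z, forall n, D z -> `|f_ n z| <= g z} ->
  mu.-integrable D (EFin \o f) /\
  \int[mu]_(z in D) f_ n z @[n --> \oo] --> \int[mu]_(z in D) f z.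
Proof.
move=> mf_ mf f_f ig f_g.
have [|||||fi _ cvg_int] := @dominated_convergence _ T R mu D mD
  (fun n => EFin \o f_ n) (EFin \o f) (EFin \o g).
- by move=> n; exact/measurable_EFinP.
- exact/measurable_EFinP.
- apply: filterS f_f => z + Dz => /(_ Dz) f_f.
  by apply: cvg_EFin; [exact: nearW|exact: f_f].
- by [].
- by apply: filterS f_g => z + n Dz => /(_ n Dz); rewrite lee_fin.
split=> //.
apply: fine_cvg.
by rewrite fineK; [exact: cvg_int|exact: integrable_fin_num].
Qed.

(** * Accumulation points solve the original problem *)

Theorem theorem4p1 (R : realType) (d J : nat) (hJ : (1 <= J)%N)
  (dOmega : measure_display) (Omega : measurableType dOmega)
  (Pr : probability Omega R) (xi : {RV Pr >-> d.-tuple R})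
  (Xi : set (d.-tuple R)) (hXi : is_support (distribution Pr xi) Xi)
  (c : 'rV[R]_J) (hc : forall j, 0 < c ord0 j)
  (a : 'cV[R]_J) (ha : forall j, 0 < a j ord0)
  (p : d.-tuple R -> 'cV[R]_J) (hp : vec_measurable Xi p)
  (hp_int : forall j,
     (distribution Pr xi).-integrable Xi ((fun z => (p z j ord0)%:E)^\+)%E)
  (gamma : d.-tuple R -> R) (hgamma : measurable_fun Xi gamma)
  (hgamma_ge0 : forall z, Xi z -> 0 <= gamma z)
  (gamma0 : R) (hgamma0 : 0 < gamma0)
  (hgamma_lb : {ae distribution Pr xi, forall z, Xi z -> gamma0 <= gamma z})
  (xe : R -> 'cV[R]_J) (ye le : R -> d.-tuple R -> 'cV[R]_J)
  (hsol : forall eps : R, 0 < eps ->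
     regularized_solution (distribution Pr xi) Xi c a gamma p eps
       (xe eps) (ye eps) (le eps))
  (x : 'cV[R]_J) (y l : d.-tuple R -> 'cV[R]_J)
  (hacc : accumulation_point (distribution Pr xi) Xi xe ye le x y l) :
  two_stage_solution (distribution Pr xi) Xi c a gamma p x y l.
Proof.
have [mXi _ _ _] := hXi.
have [my [ml [eps [[eps_gt0 eps_cvg] x_cvg y_cvg l_cvg]]]] := hacc.
set P := distribution Pr xi in hsol hgamma_lb y_cvg l_cvg hp_int *.
have sol k := hsol _ (eps_gt0 k).
have x_ge0 k : vec_ge0 (xe (eps k)) by have [_ _ [] ] := sol k.
have stage2 : {ae P, forall z k, Xi z ->
    complementary (col_mx (ye (eps k) z) (le (eps k) z))
      (block_mx (Pi_mx J (gamma z)) 1%:M (- 1%:M) (eps k)%:M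
         *m col_mx (ye (eps k) z) (le (eps k) z)
       + col_mx (- p z) (xe (eps k)))}.
  by apply: ae_foralln => k; have [] := sol k.
have M0 : 0 = (0 : R)%:M :> 'M[R]_J by rewrite raddf0.
have stage2_lim : second_stage P Xi gamma p 0 x y l.
  rewrite M0.
  apply: filterS3 stage2 y_cvg l_cvg => z sz yz lz Xz.
  exact: (second_stage_cvg (fun k => sz k Xz) eps_cvg x_cvg (yz Xz) (lz Xz)).
have l_dom j : {ae P, forall z k, Xi z ->
    `|le (eps k) z j ord0| <= Num.max (p z j ord0) 0}.
  apply: filterS stage2 => z sz k Xz.
  have [l0 _ _] := (second_stage_coordP.1 (sz k Xz) j).2.
  rewrite ger0_norm //.
  exact: (multiplier_le (hgamma_ge0 z Xz) (eps_gt0 k) (x_ge0 k) (sz k Xz)).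
have l_lim j : P.-integrable Xi (fun z => (l z j ord0)%:E) /\
    \int[P]_(z in Xi) le (eps k) z j ord0 @[k --> \oo]
      --> \int[P]_(z in Xi) l z j ord0.
  apply: (Rintegral_dominated_convergence mXi _ (ml j) _ _ (l_dom j)).
  - move=> k; have [_ il _ _] := sol k.
    by have /integrableP[/measurable_EFinP] := il j.
  - by apply: filterS l_cvg => z lz Xz; exact: cvg_coord (lz Xz).
  - by apply: eq_integrable (hp_int j) => // z _; rewrite funeposE /= EFin_max.
split=> //.
(* Where the lower right block is 0, the lower row reads [y j <= x j]; the sum
   is one bound valid for all [j]. *)
- split=> //; exists (\sum_i `|x i ord0|).
  rewrite M0 in stage2_lim.
  apply: filterS stage2_lim => z sz Xz j.
  have [[y0 _ _] [_ + _]] := second_stage_coordP.1 (sz Xz) j.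
  rewrite mul0r addr0 subr_ge0 ger0_norm // => /le_trans; apply.
  by rewrite (bigD1 j) //= (le_trans (ler_norm _)) // lerDl sumr_ge0.
- by move=> j; have [] := l_lim j.
- apply: (first_stage_cvg _ x_cvg (fun j => (l_lim j).2)) => k.
  by have [] := sol k.
Qed.
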